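(* Let $\theta$ be a rotation angle and $p\in[0,1]$ the error probability, and consider the two-qubit channel $\mathcal{N}'_{\mathcal{ZZ}}=(1-p)\mathcal{R}_{ZZ}(\theta)+p\,\mathcal{Z}_1\circ\mathcal{R}_{ZZ}(\theta)$. Then $\mathcal{N}'_{\mathcal{ZZ}}$ has the feasible decomposition (for the augmented channel extent) $$\mathcal{N}'_{\mathcal{ZZ}}=(1-2p)\,\mathcal{R}_{ZZ}(\theta)+2p\,\mathcal{E}$$ where $\mathcal{E}(\cdot)=K_0(\cdot)K_0^\dagger+K_1(\cdot)K_1^\dagger$ is a convex-Gaussian channel with $$K_0=|0\rangle\langle0|\otimes R_Z(\theta),\qquad K_1=|1\rangle\langle1|\otimes R_Z(-\theta).$$
   Context: $\mathcal{R}_{ZZ}(\theta)(\cdot)=R_{ZZ}(\theta)(\cdot)R_{ZZ}(\theta)^\dagger$ with $R_{ZZ}(\theta)=e^{-i\theta Z\otimes Z/2}$; $R_Z(\theta)=e^{-i\theta Z/2}$; $\mathcal{Z}_1(\cdot)=(Z\otimes I)(\cdot)(Z\otimes I)$. On $n$ qubits let $c_{2j-1}=Z^{\otimes(j-1)}\otimes X\otimes I^{\otimes(n-j)}$ and $c_{2j}=Z^{\otimes(j-1)}\otimes Y\otimes I^{\otimes(n-j)}$, $j=1,\dots,n$. The set $G_n$ of Gaussian unitaries consists of the $n$-qubit unitaries $V$ for which there is $R\in O(2n)$ with $Vc_jV^\dagger=\sum_kR_{j,k}c_k$ for all $j$; pure Gaussian states are the states $V|0\rangle^{\otimes n}$,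 $V\in G_n$. A convex-Gaussian channel is a CPTP map which maps convex mixtures of pure Gaussian states to convex mixtures of pure Gaussian states. A feasible decomposition of a channel $\mathcal{N}$ for the augmented channel extent is an identity $\mathcal{N}=\sum_jp_j\mathcal{V}_j+\sum_kq_k\mathcal{G}_k$ with $\mathcal{V}_j$ unitary channels, $\mathcal{G}_k$ convex-Gaussian channels, $p_j,q_k\ge0$ and $\sum_jp_j+\sum_kq_k=1$.
   Formalization: Feasibility of the decomposition is asserted only for p ≤ 1/2, since for p > 1/2 the weight 1−2p is negative; the channel identity and the convex-Gaussian property of E are proved for all p in [0,1]. *)

(* Defs.v *)
From HB Require Import structures.
From mathcomp Require Import all_boot all_order all_algebra.
From mathcomp Require Import all_classical all_reals all_analysis.
From mathcomp Require Import complex.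
From mathcomp Require mxtens.

Set Implicit Arguments.
Unset Strict Implicit.
Unset Printing Implicit Defensive.

Import Order.TTheory GRing.Theory Num.Theory.
Import numFieldNormedType.Exports.

Local Open Scope classical_set_scope.
Local Open Scope ring_scope.
Local Open Scope complex_scope.
Local Open Scope sesquilinear_scope.

(* Only the Kronecker product of mxtens is needed; importing the file would
   make its "A ^t k" clash with the "M ^t phi" of sesquilinear_scope. *)
Notation "A *t B" := (mxtens.tensmx A B)
  (at level 40, left associativity, format "A  *t  B") : ring_scope.

(* Stated over an abstract field because the topology of a numeric field is
   inferred from its structure, not from the concrete type R[i]. *)
Definition expmx (C : numClosedFieldType) (d : nat) (A : 'M[C]_d) : 'M[C]_d :=
  limn (series (fun k : nat => k`!%:R^-1 *: A ^+ k)).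

Section Operators.
Variable R : realType.
Local Notation C := R[i].

Definition pauliX : 'M[C]_2 := \matrix_(a, b) (a != b)%:R.
Definition pauliY : 'M[C]_2 :=
  \matrix_(a, b) if a == b then 0 else if a == 0 then - 'i else 'i.
Definition pauliZ : 'M[C]_2 :=
  \matrix_(a, b) if a == b then (-1) ^+ a else 0.

(* |a><a| *)
Definition ketbra (a : 'I_2) : 'M[C]_2 := delta_mx a a.

Definition RZ (theta : R) : 'M[C]_2 :=
  expmx (- ('i * (theta / 2)%:C) *: pauliZ).

Definition RZZ (theta : R) : 'M[C]_(2 ^ 2) :=
  expmx (- ('i * (theta / 2)%:C) *: (pauliZ *t pauliZ)).

(* A 0 (x) A 1 (x) ... (x) A (n-1); the cast is along 2 * 2 ^ n = 2 ^ n.+1 *)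
Fixpoint tensor_seq (n : nat) (A : nat -> 'M[C]_2) : 'M[C]_(2 ^ n) :=
  if n is m.+1 return 'M[C]_(2 ^ n) then
    castmx (esym (expnS 2 m), esym (expnS 2 m))
      (A 0%N *t tensor_seq m (fun j => A j.+1))
  else 1%:M.

(* Indices start at 0: majorana n k is c_(k+1), so that the even k = 2(j-1)
   carries X and the odd k = 2j-1 carries Y, both on the qubit j-1 = k./2. *)
Definition majorana (n : nat) (k : 'I_(2 * n)) : 'M[C]_(2 ^ n) :=
  tensor_seq n (fun j => if (j < k./2)%N then pauliZ
                         else if j == k./2 then
                           (if odd k then pauliY else pauliX)
                         else 1%:M).

Definition gaussian_unitary (n : nat) (V : 'M[C]_(2 ^ n)) : Prop :=
  V \is unitarymx /\
  exists O : 'M[R]_(2 * n), O *m O^T = 1%:M /\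
    forall j : 'I_(2 * n),
      V *m majorana j *m V^t* = \sum_(k < 2 * n) (O j k)%:C *: majorana k.

(* |0>^{(x) n}; the cast is along 1 ^ n = 1 *)
Definition ket0 (n : nat) : 'cV[C]_(2 ^ n) :=
  castmx (erefl, exp1n n) (mxtens.ntensmx (delta_mx 0 0 : 'cV[C]_2) n).

Definition pure_gaussian (n : nat) (psi : 'cV[C]_(2 ^ n)) : Prop :=
  exists2 V : 'M[C]_(2 ^ n), gaussian_unitary V & psi = V *m ket0 n.

Definition convex_gaussian (n : nat) (rho : 'M[C]_(2 ^ n)) : Prop :=
  exists (m : nat) (w : 'I_m -> R) (psi : 'I_m -> 'cV[C]_(2 ^ n)),
    [/\ forall l, 0 <= w l,
        \sum_(l < m) w l = 1,
        forall l, pure_gaussian (psi l)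
      & rho = \sum_(l < m) (w l)%:C *: (psi l *m (psi l)^t*)].

(* On R[i], 0 <= z means that z is real and nonnegative; over the complex
   numbers the condition below therefore also makes A Hermitian. *)
Definition psdmx (d : nat) (A : 'M[C]_d) : Prop :=
  forall v : 'cV[C]_d, 0 <= (v^t* *m A *m v) 0 0.

(* (id_k (x) N)(M) = \sum_(i, j) |i><j| (x) N(M_ij), where M_ij is the
   (i, j) block of M, of size d *)
Definition ampliation (k d : nat) (N : 'M[C]_d -> 'M[C]_d)
    (M : 'M[C]_(k * d)) : 'M[C]_(k * d) :=
  \sum_(i < k) \sum_(j < k)
    (delta_mx i j : 'M[C]_k) *t
    N (\matrix_(a < d, b < d)
         M (mxtens.mxtens_index (i, a)) (mxtens.mxtens_index (j, b))).

Definition cptp (d : nat) (N : 'M[C]_d -> 'M[C]_d) : Prop :=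
  [/\ linear N,
      forall (k : nat) (M : 'M[C]_(k * d)), psdmx M -> psdmx (ampliation N M)
    & forall M : 'M[C]_d, \tr (N M) = \tr M].

Definition conj_map (d : nat) (K M : 'M[C]_d) : 'M[C]_d := K *m M *m K^t*.

Definition unitary_channel (d : nat) (N : 'M[C]_d -> 'M[C]_d) : Prop :=
  exists2 U : 'M[C]_d, U \is unitarymx & N =1 conj_map U.

Definition convex_gaussian_channel (n : nat)
    (N : 'M[C]_(2 ^ n) -> 'M[C]_(2 ^ n)) : Prop :=
  cptp N /\ forall rho, convex_gaussian rho -> convex_gaussian (N rho).

Definition feasible_decomposition (n : nat)
    (N : 'M[C]_(2 ^ n) -> 'M[C]_(2 ^ n))
    (J : nat) (p : 'I_J -> R) (V : 'I_J -> 'M[C]_(2 ^ n) -> 'M[C]_(2 ^ n))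
    (K : nat) (q : 'I_K -> R) (G : 'I_K -> 'M[C]_(2 ^ n) -> 'M[C]_(2 ^ n))
    : Prop :=
  cptp N /\
  [/\ forall j, unitary_channel (V j),
      forall k, convex_gaussian_channel (G k),
      (forall j, 0 <= p j) /\ (forall k, 0 <= q k),
      \sum_(j < J) p j + \sum_(k < K) q k = 1
    & forall M, N M = \sum_(j < J) (p j)%:C *: V j M
                      + \sum_(k < K) (q k)%:C *: G k M].

Definition RZZ_channel (theta : R) : 'M[C]_(2 ^ 2) -> 'M[C]_(2 ^ 2) :=
  conj_map (RZZ theta).

Definition Z1_channel (M : 'M[C]_(2 ^ 2)) : 'M[C]_(2 ^ 2) :=
  (pauliZ *t 1%:M) *m M *m (pauliZ *t 1%:M).

Definition noisy_RZZ (theta p : R) (M : 'M[C]_(2 ^ 2)) : 'M[C]_(2 ^ 2) :=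
  (1 - p)%:C *: RZZ_channel theta M
  + p%:C *: Z1_channel (RZZ_channel theta M).

Definition K0 (theta : R) : 'M[C]_(2 ^ 2) := ketbra 0 *t RZ theta.
Definition K1 (theta : R) : 'M[C]_(2 ^ 2) := ketbra 1 *t RZ (- theta).

Definition adaptive_RZ (theta : R) (M : 'M[C]_(2 ^ 2)) : 'M[C]_(2 ^ 2) :=
  conj_map (K0 theta) M + conj_map (K1 theta) M.

End Operators.

(* Main.v *)
(** With [K0] and [K1] block diagonal in the first qubit, Euler's formula gives
    [RZZ = K0 + K1] and [Z1 RZZ = K0 - K1], so the decomposition is the
    parallelogram identity for [K |-> K M K^*].

    For two qubits the parity [Z (x) Z] anticommutes with all four Majorana
    operators.  If [V] is Gaussian then so does [Q = V (Z (x) Z) V^*]; this forces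
    [Q] to be diagonal with entries changing sign with the parity of the basis
    state.  Since [Q] fixes [V |00>], a pure Gaussian state is supported on basis
    states of a single parity.  Hence in a convex-Gaussian state the coherences
    inside a fixed value of the first qubit vanish, and the remaining off-diagonal
    ones are killed by the projections in [K0], [K1]: the adaptive channel outputs
    the diagonal of its input, a mixture of computational basis states, which are
    Gaussian through [V = X^i (x) X^a]. *)
Require Import Defs.
From mathcomp Require Import all_boot all_order all_algebra.
From mathcomp Require Import all_classical all_reals all_analysis.
From mathcomp Require Import complex.
From mathcomp Require Import ring.
From mathcomp Require mxtens.
Import Order.TTheory GRing.Theory Num.Theory.
Import numFieldNormedType.Exports.
Local Open Scope ring_scope.
Local Open Scope complex_scope.
Local Open Scope sesquilinear_scope.
Local Open Scope classical_set_scope.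

Set Implicit Arguments.
Unset Strict Implicit.
Unset Printing Implicit Defensive.

(** * Exponential of an involution and Euler's formula *)

(** Since [A] squares to the identity, its even powers are [1] and its odd powers are [A], so each
    partial sum of the exponential is a scalar partial sum times [1] plus another times [A]. The
    coefficients [u] and [v] are kept abstract so that known series can be plugged in. *)
Lemma expmx_involution (C : numClosedFieldType) (d : nat) (A : 'M[C]_d)
    (z a b : C) (u v : nat -> C) :
  A *m A = 1%:M ->
  (forall k, u k = if odd k then 0 else z ^+ k / k`!%:R) ->
  (forall k, v k = if odd k then z ^+ k / k`!%:R else 0) ->
  series u n @[n --> \oo] --> a -> series v n @[n --> \oo] --> b ->
  expmx (z *: A) = a *: 1%:M + b *: A.
Proof.
move=> AA uE vE ua vb; rewrite /expmx; apply: (cvg_lim (@norm_hausdorff _ _)).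
have powE k : (z *: A) ^+ k = z ^+ k *: (if odd k then A else 1%:M).
  elim: k => [|k IH] /=; first by rewrite !expr0 scale1r.
  rewrite exprS IH -[LHS]/((z *: A) *m _) -scalemxAr -scalemxAl scalerA -exprSr.
  by case: (odd k); rewrite ?AA ?mulmx1.
have termE k : k`!%:R^-1 *: (z *: A) ^+ k = u k *: 1%:M + v k *: A.
  by rewrite powE scalerA mulrC uE vE; case: (odd k);
    rewrite scale0r ?add0r ?addr0.
rewrite [X in X @ _](_ : _ =
    fun n => series u n *: (1%:M : 'M[C]_d) + series v n *: A).
  by apply: cvgD; apply: cvgZr_tmp.
apply/funext => n; rewrite /series /= !scaler_suml -big_split /=.
by apply: eq_bigr => k _; rewrite termE.
Qed.

Lemma cvg_realc (R : realType) (u : nat -> R) (l : R) :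
  u n @[n --> \oo] --> l ->
  ((u n)%:C : (R[i] : numClosedFieldType)) @[n --> \oo] --> (l%:C : (R[i] : numClosedFieldType)).
Proof.
move=> /cvgrPdist_lt ul; apply/cvgrPdist_lt => e e0.
(* A positive element of [R[i]] is real, so [Re e] can serve as the tolerance for the real
   sequence. *)
have eE : e = (complex.Re e)%:C by rewrite RRe_real// ger0_real// ltW.
have re0 : 0 < complex.Re e by rewrite -ltcR -eE.
near=> n; rewrite eE -rmorphB normc_def /= expr0n addr0 sqrtr_sqr ltcR.
by near: n; apply: ul.
Unshelve. all: by end_near. Qed.

Lemma exp_i_even (R : realType) (t : R) (m : nat) :
  (- ('i * t%:C)) ^+ m.*2 = ((-1) ^+ m * t ^+ m.*2)%:C.
Proof.
have sq : (- ('i * t%:C)) ^+ 2 = (- t ^+ 2)%:C.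
  by rewrite sqrrN exprMn [_ ^+ 2]sqrCi mulN1r rmorphN rmorphXn.
by rewrite -mul2n !exprM sq -rmorphXn /= [(- t ^+ 2) ^+ m]exprNn.
Qed.

(** The even terms of the exponential series are the cosine coefficients, and the odd ones are
    [- 'i] times the sine coefficients. *)
Lemma expmx_Euler (R : realType) (d : nat) (A : 'M[R[i]]_d) (t : R) :
  A *m A = 1%:M ->
  expmx (- ('i * t%:C) *: A) = (cos t)%:C *: 1%:M - ('i * (sin t)%:C) *: A.
Proof.
move=> AA; rewrite -scaleNr.
apply: (expmx_involution (u := fun k => (cos_coeff t k)%:C)
  (v := fun k => - 'i * (sin_coeff t k)%:C)) => //.
- move=> k; rewrite /cos_coeff /=; case: ifPn => ok; first by rewrite !mul0r.
  have [m ->] : exists m, k = m.*2.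
    by exists k./2; rewrite -[LHS]odd_double_half (negbTE ok).
  by rewrite doubleK mul1r exp_i_even rmorphM fmorphV rmorph_nat.
- move=> k; rewrite /sin_coeff /=; case: ifPn => ok; last by rewrite !mul0r mulr0.
  have [m ->] : exists m, k = m.*2.+1.
    by exists k./2; rewrite -[LHS]odd_double_half ok.
  rewrite /= doubleK mul1r [(- ('i * _)) ^+ _]exprS exp_i_even [t ^+ _.+1]exprS.
  by rewrite !rmorphM fmorphV rmorph_nat /=; ring.
- have -> : (fun n => series (fun k => (cos_coeff t k)%:C) n) =
      fun n => (series (cos_coeff t) n)%:C.
    by apply/funext => n; rewrite /series /= rmorph_sum.
  (* [cos] is locked; unlocked, it is by definition the limit of this series. *)
  apply: cvg_realc; rewrite unlock; exact: is_cvg_series_cos_coeff.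
- have -> : (fun n => series (fun k => - 'i * (sin_coeff t k)%:C) n) =
      fun n => - 'i * (series (sin_coeff t) n)%:C.
    by apply/funext => n; rewrite /series /= rmorph_sum mulr_sumr.
  rewrite -mulNr.
  apply: (@cvgMl_tmp (R[i] : numClosedFieldType)).
  apply: cvg_realc; rewrite unlock; exact: is_cvg_series_sin_coeff.
Qed.

(** * Kronecker products and adjoints *)

Lemma sum_mxtens (V : nmodType) (k d : nat) (F : 'I_(k * d) -> V) :
  \sum_x F x = \sum_i \sum_a F (mxtens.mxtens_index (i, a)).
Proof.
rewrite pair_big (reindex (@mxtens.mxtens_index k d)) /=.
  by apply: eq_bigr => -[].
by exists (@mxtens.mxtens_unindex k d) => x _;
  rewrite (mxtens.mxtens_indexK, mxtens.mxtens_unindexK).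
Qed.

Lemma tensmx_eqP (R : pzRingType) (k d k' d' : nat) (M N : 'M[R]_(k * d, k' * d')) :
  (forall i a j b, M (mxtens.mxtens_index (i, a)) (mxtens.mxtens_index (j, b)) =
    N (mxtens.mxtens_index (i, a)) (mxtens.mxtens_index (j, b))) -> M = N.
Proof.
move=> MN; apply/matrixP => x y.
by case: (mxtens.mxtens_indexP x) => i a; case: (mxtens.mxtens_indexP y).
Qed.

Section TensorProduct.
Variables (R : comPzRingType) (m n p q : nat).
Implicit Types (A : 'M[R]_(m, n)) (B : 'M[R]_(p, q)).

Lemma tensmxDl A A' B : (A + A') *t B = A *t B + A' *t B.
Proof. by apply/matrixP => x y; rewrite !mxE mulrDl. Qed.

Lemma tensmxDr A B B' : A *t (B + B') = A *t B + A *t B'.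
Proof. by apply/matrixP => x y; rewrite !mxE mulrDr. Qed.

Lemma tensmxZl a A B : (a *: A) *t B = a *: (A *t B).
Proof. by apply/matrixP => x y; rewrite !mxE mulrA. Qed.

Lemma tensmxZr a A B : A *t (a *: B) = a *: (A *t B).
Proof. by apply/matrixP => x y; rewrite !mxE mulrCA. Qed.

End TensorProduct.

Lemma tensmx11 (R : comPzRingType) (m n : nat) :
  (1%:M : 'M[R]_m) *t (1%:M : 'M[R]_n) = 1%:M.
Proof.
apply: tensmx_eqP => i a j b; rewrite mxtens.tensmxE !mxE -natrM mulnb.
by rewrite (can_eq (@mxtens.mxtens_indexK _ _)) xpair_eqE.
Qed.

Section Adjoint.
Variable C : numClosedFieldType.

Lemma adjmx_tens (m n p q : nat) (A : 'M[C]_(m, n)) (B : 'M[C]_(p, q)) :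
  (A *t B)^t* = A^t* *t B^t*.
Proof. by rewrite mxtens.trmx_tens mxtens.map_mxT. Qed.

Lemma adjmx_mul (m n p : nat) (A : 'M[C]_(m, n)) (B : 'M[C]_(n, p)) :
  (A *m B)^t* = B^t* *m A^t*.
Proof. by rewrite trmx_mul map_mxM. Qed.

Lemma adjmxD (m n : nat) (A B : 'M[C]_(m, n)) : (A + B)^t* = A^t* + B^t*.
Proof. by rewrite linearD /= map_mxD. Qed.

Lemma adjmxN (m n : nat) (A : 'M[C]_(m, n)) : (- A)^t* = - A^t*.
Proof. by rewrite linearN /= map_mxN. Qed.

Lemma adjmxZ (m n : nat) a (A : 'M[C]_(m, n)) : (a *: A)^t* = a^* *: A^t*.
Proof. by rewrite linearZ /= map_mxZ. Qed.

Lemma adjmx1 (n : nat) : (1%:M : 'M[C]_n)^t* = 1%:M.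
Proof. by rewrite trmx1 map_mx1. Qed.

Lemma adjmx_delta (m n : nat) (i : 'I_m) (j : 'I_n) :
  (delta_mx i j : 'M[C]_(m, n))^t* = delta_mx j i.
Proof. by rewrite trmx_delta map_delta_mx. Qed.

End Adjoint.

(** * Kraus form and complete positivity *)

Section Kraus.
Variable R : realType.
Local Notation C := R[i].

(** This is the block to which [ampliation] applies the map; under the name, products with
    [1%:M *t A] can be computed block by block. *)
Definition blockmx (k d : nat) (i j : 'I_k) (M : 'M[C]_(k * d)) : 'M[C]_d :=
  \matrix_(a, b) M (mxtens.mxtens_index (i, a)) (mxtens.mxtens_index (j, b)).

Lemma ampliationE (k d : nat) (N : 'M[C]_d -> 'M[C]_d) (M : 'M[C]_(k * d)) i a j b :
  ampliation N M (mxtens.mxtens_index (i, a)) (mxtens.mxtens_index (j, b)) =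
  N (blockmx i j M) a b.
Proof.
rewrite /ampliation summxE (bigD1 i) //= summxE (bigD1 j) //=.
rewrite mxtens.tensmxE mxE !eqxx mul1r big1 ?addr0 => [|j' /negbTE j'j]; last first.
  by rewrite mxtens.tensmxE mxE eqxx [j == _]eq_sym j'j mul0r.
rewrite big1 ?addr0 // => i' /negbTE i'i; rewrite summxE big1 // => j' _.
by rewrite mxtens.tensmxE mxE [i == _]eq_sym i'i mul0r.
Qed.

Lemma blockmx_mull (k d : nat) (i j : 'I_k) (A : 'M[C]_d) (M : 'M[C]_(k * d)) :
  blockmx i j ((1%:M *t A) *m M) = A *m blockmx i j M.
Proof.
apply/matrixP => a b; rewrite !mxE sum_mxtens (bigD1 i) //=.
rewrite [X in _ + X]big1 ?addr0 => [|i' /negbTE i'i]; last first.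
  by rewrite big1 // => c _; rewrite mxtens.tensmxE mxE eq_sym i'i !mul0r.
by apply: eq_bigr => c _; rewrite mxtens.tensmxE !mxE eqxx mul1r.
Qed.

Lemma blockmx_mulr (k d : nat) (i j : 'I_k) (A : 'M[C]_d) (M : 'M[C]_(k * d)) :
  blockmx i j (M *m (1%:M *t A)) = blockmx i j M *m A.
Proof.
apply/matrixP => a b; rewrite !mxE sum_mxtens (bigD1 j) //=.
rewrite [X in _ + X]big1 ?addr0 => [|j' /negbTE j'j]; last first.
  by rewrite big1 // => c _; rewrite mxtens.tensmxE mxE j'j mul0r mulr0.
by apply: eq_bigr => c _; rewrite mxtens.tensmxE !mxE eqxx mul1r.
Qed.

Lemma psdmx_conj_map (d : nat) (K M : 'M[C]_d) : psdmx M -> psdmx (conj_map K M).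
Proof.
move=> M0 v; have := M0 (K^t* *m v).
by rewrite adjmx_mul trmxCK /conj_map !mulmxA.
Qed.

(** The ampliation is again of Kraus form, with operators [1%:M *t K l], and conjugations preserve
    positivity; the trace is preserved by cyclicity and the completeness relation. Weights are kept
    apart from the operators so that mixtures of unitary conjugations require no square roots. *)
Lemma cptp_kraus (d r : nat) (w : 'I_r -> R) (K : 'I_r -> 'M[C]_d)
    (N : 'M[C]_d -> 'M[C]_d) :
  (forall l, 0 <= w l) ->
  \sum_l (w l)%:C *: ((K l)^t* *m K l) = 1%:M ->
  (forall M, N M = \sum_l (w l)%:C *: conj_map (K l) M) -> cptp N.
Proof.
move=> w0 K1 NE; split.
- move=> a M M'; rewrite !NE scaler_sumr -big_split /=; apply: eq_bigr => l _.
  rewrite /conj_map mulmxDr mulmxDl -scalemxAr -scalemxAl scalerDr.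
  by rewrite !scalerA mulrC.
- move=> k M M0 v.
  have -> : ampliation N M = \sum_l (w l)%:C *: conj_map (1%:M *t K l) M.
    apply: tensmx_eqP => i a j b; rewrite ampliationE NE !summxE.
    apply: eq_bigr => l _; rewrite [LHS]mxE [RHS]mxE.
    have -> : conj_map (K l) (blockmx i j M) = blockmx i j (conj_map (1%:M *t K l) M).
      by rewrite /conj_map adjmx_tens adjmx1 blockmx_mulr blockmx_mull.
    by rewrite mxE.
  rewrite mulmx_sumr mulmx_suml summxE sumr_ge0 // => l _.
  rewrite -scalemxAr -scalemxAl mxE mulr_ge0 ?ler0c //.
  exact: psdmx_conj_map.
- move=> M; rewrite NE raddf_sum -[in RHS](mul1mx M) -K1 mulmx_suml raddf_sum /=.
  apply: eq_bigr => l _.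
  by rewrite -scalemxAl !mxtraceZ /conj_map mxtrace_mulC mulmxA.
Qed.

End Kraus.

(** * Closed forms of the rotations *)

Section Rotations.
Variable R : realType.
Local Notation C := R[i].
Local Notation Z := (pauliZ R).

Lemma ketbraD : ketbra R 0 + ketbra R 1 = 1%:M.
Proof.
apply/matrixP => -[[|[|//]] ?] [[|[|//]] ?]; rewrite !mxE -!val_eqE /=;
  by rewrite ?addr0 ?add0r.
Qed.

Lemma ketbraB : ketbra R 0 - ketbra R 1 = Z.
Proof.
apply/matrixP => -[[|[|//]] ?] [[|[|//]] ?]; rewrite !mxE -!val_eqE /=;
  by rewrite ?subr0 ?sub0r ?expr0 ?expr1.
Qed.

Lemma ketbra_mul (a b : 'I_2) : ketbra R a *m ketbra R b = (a == b)%:R *: ketbra R a.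
Proof.
rewrite /ketbra; case: eqVneq => [->|ab]; rewrite ?scale1r ?scale0r.
  exact: mul_delta_mx.
exact: mul_delta_mx_0.
Qed.

Lemma ketbra_adj (a : 'I_2) : (ketbra R a)^t* = ketbra R a.
Proof. exact: adjmx_delta. Qed.

Lemma pauliZ_adj : Z^t* = Z.
Proof. by rewrite -ketbraB adjmxD adjmxN !ketbra_adj. Qed.

Lemma pauliZ_sqr : Z *m Z = 1%:M.
Proof.
rewrite -ketbraB mulmxBl !mulmxBr !ketbra_mul !eqxx /= !scale0r !scale1r.
by rewrite subr0 sub0r opprK ketbraD.
Qed.

Lemma pauliZ_ketbra0 : Z *m ketbra R 0 = ketbra R 0.
Proof. by rewrite -ketbraB mulmxBl !ketbra_mul !eqxx scale1r scale0r subr0. Qed.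

Lemma pauliZ_ketbra1 : Z *m ketbra R 1 = - ketbra R 1.
Proof. by rewrite -ketbraB mulmxBl !ketbra_mul !eqxx scale1r scale0r sub0r. Qed.

Lemma RZE (theta : R) :
  RZ theta = (cos (theta / 2))%:C *: 1%:M - ('i * (sin (theta / 2))%:C) *: Z.
Proof. exact/expmx_Euler/pauliZ_sqr. Qed.

Lemma RZNE (theta : R) :
  RZ (- theta) = (cos (theta / 2))%:C *: 1%:M + ('i * (sin (theta / 2))%:C) *: Z.
Proof. by rewrite RZE mulNr cosN sinN rmorphN mulrN scaleNr opprK. Qed.

Lemma conj_realc (x : R) : Num.conj (x%:C) = x%:C.
Proof. by rewrite conj_Creal // complex_real. Qed.

Lemma RZ_adj (theta : R) : (RZ theta)^t* = RZ (- theta).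
Proof.
rewrite RZNE RZE adjmxD adjmxN !adjmxZ adjmx1 pauliZ_adj.
by rewrite conj_realc rmorphM /= conjCi conj_realc mulNr scaleNr opprK.
Qed.

Lemma RZ_unitary (theta : R) : (RZ theta)^t* *m RZ theta = 1%:M.
Proof.
rewrite RZ_adj RZNE RZE; set a := (cos _)%:C; set b := 'i * _.
rewrite mulmxDl !mulmxBr -!scalemxAl -!scalemxAr !mul1mx mulmx1.
(* The terms in [Z] cancel, leaving [a * a - b * b], where [b] is imaginary; this becomes the sum of
   the squares of cosine and sine. *)
rewrite pauliZ_sqr !scalerA [a * b]mulrC addrA subrK -scalerBl.
have -> : b * b = - (sin (theta / 2) ^+ 2)%:C.
  by rewrite -expr2 exprMn [_ ^+ 2]sqrCi mulN1r rmorphXn.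
by rewrite opprK -rmorphM -rmorphD /= -expr2 cos2Dsin2 scale1r.
Qed.

(** When the first qubit is 0 or 1, [Z *t Z] acts on the second as [Z] or [- Z], so the rotation
    angle is [theta] or [- theta]. *)
Lemma RZZE (theta : R) : RZZ theta = K0 theta + K1 theta.
Proof.
rewrite /RZZ expmx_Euler; last first.
  by rewrite mxtens.tensmx_mul pauliZ_sqr tensmx11.
rewrite /K0 /K1 RZNE RZE !tensmxDr addrACA -tensmxDl ketbraD.
rewrite [in RHS]tensmxZr tensmx11; congr (_ + _).
by rewrite -!scaleNr !tensmxZr -ketbraB tensmxDl -[- ketbra R 1]scaleN1r tensmxZl
  scalerDr !scalerA mulrN1 opprK.
Qed.

Lemma Z1_RZZ (theta : R) : (Z *t 1%:M) *m RZZ theta = K0 theta - K1 theta.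
Proof.
have ZK (a : 'I_2) (A : 'M[C]_2) : (Z *t 1%:M) *m (ketbra R a *t A) =
    (Z *m ketbra R a) *t A by rewrite mxtens.tensmx_mul mul1mx.
rewrite RZZE mulmxDr /K0 /K1 [X in X + _]ZK [X in _ + X]ZK.
rewrite pauliZ_ketbra0 pauliZ_ketbra1.
by rewrite -[- ketbra R 1]scaleN1r tensmxZl scaleN1r.
Qed.

End Rotations.

(** * The channel identity and trace preservation *)

Section Channels.
Variable R : realType.
Local Notation C := R[i].

(** The cross terms [A *m M *m B^t*] and [B *m M *m A^t*] enter the conjugations by [A + B] and
    [A - B] with opposite signs. *)
Lemma conj_map_parallelogram (d : nat) (A B M : 'M[C]_d) :
  conj_map (A - B) M = (conj_map A M + conj_map B M) *+ 2 - conj_map (A + B) M.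
Proof.
apply/eqP; rewrite eq_sym subr_eq /conj_map !adjmxD adjmxN.
rewrite !mulmxDl !mulNmx !mulmxDr !mulmxN.
(* Once the four products are generalised, the claim is an identity in an abelian group. *)
move: (A *m M *m A^t*) (B *m M *m B^t*) (A *m M *m B^t*) (B *m M *m A^t*).
move=> a b c e; rewrite opprB addrACA [a - c + _]addrACA addNr addr0.
by rewrite [b - e + _]addrA subrK mulr2n addrACA.
Qed.

Lemma K0_adj_mul (theta : R) : (K0 theta)^t* *m K0 theta = ketbra R 0 *t 1%:M.
Proof.
by rewrite /K0 adjmx_tens mxtens.tensmx_mul RZ_unitary ketbra_adj ketbra_mul eqxx scale1r.
Qed.

Lemma K1_adj_mul (theta : R) : (K1 theta)^t* *m K1 theta = ketbra R 1 *t 1%:M.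
Proof.
by rewrite /K1 adjmx_tens mxtens.tensmx_mul RZ_unitary ketbra_adj ketbra_mul eqxx scale1r.
Qed.

Lemma K0_adj_mul_K1 (theta : R) : (K0 theta)^t* *m K1 theta = 0.
Proof.
by rewrite /K0 /K1 adjmx_tens mxtens.tensmx_mul ketbra_adj ketbra_mul scale0r
  mxtens.tens0mx.
Qed.

Lemma K1_adj_mul_K0 (theta : R) : (K1 theta)^t* *m K0 theta = 0.
Proof.
by rewrite /K0 /K1 adjmx_tens mxtens.tensmx_mul ketbra_adj ketbra_mul scale0r
  mxtens.tens0mx.
Qed.

Lemma kraus_complete (theta : R) :
  (K0 theta)^t* *m K0 theta + (K1 theta)^t* *m K1 theta = 1%:M.
Proof.
rewrite [X in X + _]K0_adj_mul [X in _ + X]K1_adj_mul -tensmxDl ketbraD.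
exact: tensmx11.
Qed.

Lemma RZZ_adj_mul (theta : R) : (RZZ theta)^t* *m RZZ theta = 1%:M.
Proof.
rewrite RZZE adjmxD mulmxDl [X in X + _]mulmxDr [X in _ + X]mulmxDr [X in _ + X + _]K0_adj_mul_K1.
rewrite [X in _ + (X + _)]K1_adj_mul_K0 addr0 add0r.
exact: kraus_complete.
Qed.

Lemma RZZ_unitary (theta : R) : RZZ theta \is unitarymx.
Proof. by apply/unitarymxP/mulmx1C; exact: RZZ_adj_mul. Qed.

Lemma Z1_RZZ_channel (theta : R) (M : 'M[C]_(2 ^ 2)) :
  Z1_channel (RZZ_channel theta M) = conj_map (K0 theta - K1 theta) M.
Proof.
rewrite -Z1_RZZ /conj_map adjmx_mul adjmx_tens pauliZ_adj adjmx1.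
by rewrite /Z1_channel /RZZ_channel /conj_map !mulmxA.
Qed.

(** The parallelogram identity turns the branch with the error into twice the adaptive channel minus
    the rotation; the rotation then has total weight [(1 - p) - p]. *)
Lemma noisy_RZZE (theta p : R) (M : 'M[C]_(2 ^ 2)) :
  noisy_RZZ theta p M =
  (1 - 2 * p)%:C *: RZZ_channel theta M + (2 * p)%:C *: adaptive_RZ theta M.
Proof.
rewrite /noisy_RZZ Z1_RZZ_channel conj_map_parallelogram -RZZE.
rewrite -/(RZZ_channel theta M) -/(adaptive_RZ theta M).
rewrite scalerBr -scalerMnr scalerMnl addrCA -scalerBl addrC -rmorphB -rmorphMn.
by rewrite mulr_natl mulr2n opprD addrA.
Qed.

Lemma cptp_kraus2 (d : nat) (a b : R) (A B : 'M[C]_d) (N : 'M[C]_d -> 'M[C]_d) :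
  0 <= a -> 0 <= b -> a%:C *: (A^t* *m A) + b%:C *: (B^t* *m B) = 1%:M ->
  (forall M, N M = a%:C *: conj_map A M + b%:C *: conj_map B M) -> cptp N.
Proof.
move=> a0 b0 AB1 NE.
apply: (cptp_kraus (w := fun l : 'I_2 => if l == 0 then a else b)
  (K := fun l => if l == 0 then A else B)).
- by move=> l; case: ifP.
- by rewrite !big_ord_recl big_ord0 addr0.
- by move=> M; rewrite !big_ord_recl big_ord0 addr0 NE.
Qed.

Lemma cptp_adaptive_RZ (theta : R) : cptp (adaptive_RZ theta).
Proof.
apply: (cptp_kraus2 (a := 1) (b := 1) (A := K0 theta) (B := K1 theta)) => //.
  by rewrite [X in X + _]scale1r [X in _ + X]scale1r kraus_complete.
by move=> M; rewrite [X in _ = X + _]scale1r [X in _ = _ + X]scale1r.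
Qed.

Lemma cptp_noisy_RZZ (theta p : R) : 0 <= p <= 1 -> cptp (noisy_RZZ theta p).
Proof.
move=> /andP[p0 p1].
apply: (cptp_kraus2 (a := 1 - p) (b := p) (A := RZZ theta)
  (B := (pauliZ R *t 1%:M) *m RZZ theta));
  [by rewrite subr_ge0 | exact: p0 | |].
  have Z1_sqr : (pauliZ R *t (1%:M : 'M[C]_2))^t* *m (pauliZ R *t 1%:M) = 1%:M.
    by rewrite adjmx_tens pauliZ_adj adjmx1 mxtens.tensmx_mul pauliZ_sqr mulmx1 tensmx11.
  have ZU (U : 'M[C]_(2 * 2)) :
      ((pauliZ R *t (1%:M : 'M[C]_2)) *m U)^t* *m ((pauliZ R *t 1%:M) *m U) = U^t* *m U.
    by rewrite adjmx_mul mulmxA -[X in X *m U]mulmxA Z1_sqr mulmx1.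
  rewrite [X in _ + _ *: X]ZU RZZ_adj_mul -scalerDl -rmorphD subrK.
  exact: scale1r.
move=> M; rewrite /noisy_RZZ Z1_RZZ_channel.
by rewrite -Z1_RZZ.
Qed.

End Channels.

(** * Pauli algebra and the two-qubit Majorana operators *)

Section Majorana.
Variable R : realType.
Local Notation C := R[i].
Local Notation X := (pauliX R).
Local Notation Y := (pauliY R).
Local Notation Z := (pauliZ R).

Lemma ord2P (P : 'I_2 -> Prop) : P 0 -> P 1 -> forall i, P i.
Proof.
move=> P0 P1 [[|[|//]] lt_i]; first by rewrite [Ordinal _](_ : _ = 0) //; exact/val_inj.
by rewrite [Ordinal _](_ : _ = 1) //; exact/val_inj.
Qed.

Lemma pauliX_sqr : X *m X = 1%:M.
Proof.
apply/matrixP; do 2!apply: ord2P; rewrite !mxE !big_ord_recl big_ord0 !mxE /=;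
  by rewrite !(mulr0, mul0r, mulr1, addr0, add0r).
Qed.

Lemma pauliX_adj : X^t* = X.
Proof. by apply/matrixP => i j; rewrite !mxE eq_sym conjC_nat. Qed.

Lemma pauliXZ : X *m Z = - (Z *m X).
Proof.
apply/matrixP; do 2!apply: ord2P; rewrite !mxE !big_ord_recl !big_ord0 !mxE /=;
  by rewrite !(mulr0, mul0r, mulr1, mul1r, addr0, add0r, oppr0, expr0, expr1, opprK).
Qed.

Lemma pauliYE : Y = 'i *: (X *m Z).
Proof.
apply/matrixP; do 2!apply: ord2P; rewrite !mxE !big_ord_recl !big_ord0 !mxE /=;
  by rewrite !(mulr0, mul0r, mulr1, mul1r, addr0, add0r, oppr0, expr0, expr1, mulrN1) ?complexiE.
Qed.

Lemma pauliYZ : Y *m Z = - (Z *m Y).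
Proof.
by rewrite pauliYE -scalemxAl -scalemxAr mulmxA -scalerN -mulNmx -pauliXZ.
Qed.

Lemma pauliXYX : X *m Y *m X = - Y.
Proof.
by rewrite pauliYE -scalemxAr mulmxA pauliX_sqr mul1mx -scalemxAl -scalerN pauliXZ opprK.
Qed.

Lemma pauliXZX : X *m Z *m X = - Z.
Proof. by rewrite pauliXZ mulNmx -mulmxA pauliX_sqr mulmx1. Qed.

(** A Majorana index on two qubits is read as a pair: the qubit [k./2] and a bit [r] equal to the
    parity of [k], which selects [X] or [Y]. *)
Definition pauliXY (r : 'I_2) : 'M[C]_2 := if r == 0 then X else Y.

Lemma tensor_seq2 (A : nat -> 'M[C]_2) : tensor_seq 2 A = A 0%N *t A 1%N.
Proof.
rewrite /= castmx_id; congr (_ *t _).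
by rewrite mxtens.tens_mx_scalar scale1r castmx_comp castmx_id.
Qed.

Lemma majorana0 (r : 'I_2) :
  majorana R (n := 2) (mxtens.mxtens_index (0 : 'I_2, r)) = pauliXY r *t 1%:M.
Proof.
rewrite /majorana tensor_seq2; congr (_ *t _); by move: r; apply: ord2P.
Qed.

Lemma majorana1 (r : 'I_2) :
  majorana R (n := 2) (mxtens.mxtens_index (1 : 'I_2, r)) = Z *t pauliXY r.
Proof.
rewrite /majorana tensor_seq2; congr (_ *t _); by move: r; apply: ord2P.
Qed.

Lemma tens_delta_mx (m n p q : nat) (i : 'I_m) (j : 'I_n) (k : 'I_p) (l : 'I_q) :
  (delta_mx i j : 'M[C]_(m, n)) *t (delta_mx k l : 'M[C]_(p, q)) =
  delta_mx (mxtens.mxtens_index (i, k)) (mxtens.mxtens_index (j, l)).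
Proof.
apply: tensmx_eqP => i' a j' b; rewrite mxtens.tensmxE !mxE -natrM mulnb.
by rewrite !(can_eq (@mxtens.mxtens_indexK _ _)) !xpair_eqE andbACA.
Qed.

Lemma ket0_2 : ket0 R 2 = delta_mx (mxtens.mxtens_index (0 : 'I_2, 0 : 'I_2)) 0.
Proof.
rewrite /ket0 castmx_id [LHS]tens_delta_mx; congr delta_mx; exact: ord1.
Qed.

(** [X] commutes with itself and anticommutes with [Y], so a sign appears only for [i = r = 1]. *)
Lemma conj_pauliXn_XY (i r : 'I_2) :
  X ^+ i *m pauliXY r *m X ^+ i = (-1) ^+ (i * r)%N *: pauliXY r.
Proof.
rewrite /pauliXY; move: i r; do 2!apply: ord2P; rewrite /= ?expr0 ?expr1 ?mul1mx ?mulmx1 ?scale1r //.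
- by rewrite pauliX_sqr mul1mx.
- by rewrite pauliXYX scaleN1r.
Qed.

Lemma conj_pauliXn_Z (i : 'I_2) : X ^+ i *m Z *m X ^+ i = (-1) ^+ i *: Z.
Proof.
by move: i; apply: ord2P;
  rewrite /= ?expr0 ?expr1 ?mul1mx ?mulmx1 ?scale1r // pauliXZX scaleN1r.
Qed.

Lemma pauliXn_sqr (i : 'I_2) : X ^+ i *m X ^+ i = 1%:M.
Proof. by move: i; apply: ord2P; rewrite /= ?mul1mx // expr1 pauliX_sqr. Qed.

Lemma pauliXn_adj (i : 'I_2) : (X ^+ i)^t* = X ^+ i.
Proof. by move: i; apply: ord2P; rewrite /= ?adjmx1 // expr1 pauliX_adj. Qed.

End Majorana.

(** * Gaussian unitaries, basis states and conjugated parity *)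

Section Gaussian.
Variable R : realType.
Local Notation C := R[i].
Local Notation X := (pauliX R).
Local Notation Z := (pauliZ R).
Local Notation idx := mxtens.mxtens_index.

(** Bit flips [X ^+ i *t X ^+ a] carry the zero state to the basis state [(i, a)] and only change
    signs of the Majorana operators, so the orthogonal matrix is diagonal. *)
Lemma basis_pure_gaussian (x : 'I_(2 * 2)) :
  pure_gaussian (n := 2) (delta_mx x 0 : 'cV[C]_(2 * 2)).
Proof.
case: (mxtens.mxtens_indexP x) => i a {x}.
pose V : 'M[C]_(2 * 2) := X ^+ i *t X ^+ a.
have Vadj : V^t* = V by rewrite adjmx_tens !pauliXn_adj.
have VAB (A B : 'M[C]_2) :
    V *m (A *t B) *m V = (X ^+ i *m A *m X ^+ i) *t (X ^+ a *m B *m X ^+ a).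
  by rewrite 2!mxtens.tensmx_mul.
have VV : V *m V = 1%:M by rewrite mxtens.tensmx_mul !pauliXn_sqr tensmx11.
exists V; last first.
  rewrite ket0_2.
  have -> : (delta_mx (idx (0 : 'I_2, 0 : 'I_2)) 0 : 'cV[C]_(2 * 2)) =
      (delta_mx 0 0 : 'cV[C]_2) *t (delta_mx 0 0 : 'cV[C]_2).
    by rewrite tens_delta_mx; congr delta_mx; symmetry; exact: ord1.
  have Xn (b : 'I_2) : X ^+ b *m (delta_mx 0 0 : 'cV[C]_2) = delta_mx b 0.
    apply/matrixP => j k; rewrite [k]ord1 {k}; move: j b; do 2!apply: ord2P;
      rewrite ?expr0 ?expr1 !mxE !big_ord_recl big_ord0 !mxE /=;
      by rewrite !(mulr0, mul0r, mulr1, addr0, add0r).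
  have VD : V *m ((delta_mx 0 0 : 'cV[C]_2) *t (delta_mx 0 0 : 'cV[C]_2)) =
      (delta_mx i 0 : 'cV[C]_2) *t (delta_mx a 0 : 'cV[C]_2).
    by rewrite mxtens.tensmx_mul !Xn.
  rewrite [RHS]VD tens_delta_mx; congr delta_mx; symmetry; exact: ord1.
split.
  by apply/unitarymxP; rewrite Vadj; exact: VV.
(* The sign exponents come from [pauliXY r *t 1] on the first qubit, giving [i * r], and from
   [Z *t pauliXY r] on the second, where the factor [Z] contributes [i] and the other one
   [a * r]. *)
pose s (j : 'I_(2 * 2)) : nat := let: (q, r) := mxtens.mxtens_unindex j in
  if q == 0 then (i * r)%N else (i + a * r)%N.
exists (diag_mx (\row_j (-1) ^+ s j)); split.
  apply/matrixP => j k; rewrite tr_diag_mx mul_diag_mx !mxE.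
  by case: eqVneq => _; rewrite ?mulr0n ?mulr0 // !mulr1n -expr2 sqrr_sign.
move=> j; rewrite (bigD1 j) //= big1 ?addr0 => [|k kj]; last first.
  by rewrite !mxE eq_sym (negbTE kj) mulr0n rmorph0 scale0r.
rewrite !mxE eqxx mulr1n rmorphXn rmorphN rmorph1 Vadj.
case: (mxtens.mxtens_indexP j) => q r; rewrite /s mxtens.mxtens_indexK.
move: q; apply: ord2P; rewrite ?majorana0 ?majorana1.
  by rewrite [LHS]VAB conj_pauliXn_XY mulmx1 pauliXn_sqr tensmxZl.
rewrite [LHS]VAB conj_pauliXn_XY conj_pauliXn_Z exprD.
by rewrite [LHS]tensmxZl tensmxZr scalerA.
Qed.

(** In each Majorana operator exactly one tensor factor is [X] or [Y], which anticommutes with [Z];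
    the other is [1] or [Z], which commutes with it. *)
Lemma parity_majorana (j : 'I_(2 * 2)) :
  (Z *t Z) *m majorana R (n := 2) j = - (majorana R (n := 2) j *m (Z *t Z)).
Proof.
have ZXY (r : 'I_2) : Z *m pauliXY R r = - (pauliXY R r *m Z).
  by move: r; apply: ord2P; rewrite /pauliXY /= ?pauliXZ ?pauliYZ opprK.
case: (mxtens.mxtens_indexP j) => q r; move: q; apply: ord2P.
  by rewrite majorana0 !mxtens.tensmx_mul ZXY mulmx1 mul1mx -scaleN1r tensmxZl scaleN1r.
by rewrite majorana1 !mxtens.tensmx_mul ZXY -scaleN1r tensmxZr scaleN1r.
Qed.

(** Conjugation by [V] carries the anticommutation relations to the operators
    [V *m majorana j *m V^t*], and orthogonality makes every Majorana operator a linear combination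
    of these. *)
Lemma conj_parity_majorana (V : 'M[C]_(2 ^ 2)) (k : 'I_(2 * 2)) :
  gaussian_unitary (n := 2) V ->
  (V *m (Z *t Z) *m V^t*) *m majorana R (n := 2) k =
  - (majorana R (n := 2) k *m (V *m (Z *t Z) *m V^t*)).
Proof.
move=> [/unitarymxP VV [S [SS VS]]].
have VV' : V^t* *m V = 1%:M by exact: mulmx1C.
have -> : majorana R (n := 2) k =
    \sum_j (S j k)%:C *: (V *m majorana R (n := 2) j *m V^t*).
  (* The relation of [V] is inverted through the transpose of [S], which requires orthonormal
     columns rather than rows. *)
  have SS' : S^T *m S = 1%:M by exact: mulmx1C.
  under eq_bigr do rewrite VS scaler_sumr.
  rewrite exchange_big /= (bigD1 k) //= [X in _ + X]big1 ?addr0 => [|l lk].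
    under eq_bigr do rewrite scalerA -rmorphM /=.
    rewrite -scaler_suml -rmorph_sum /=.
    have := congr1 (fun M : 'M[R]_(2 * 2) => M k k) SS'; rewrite !mxE eqxx => SS1.
    rewrite (eq_bigr (fun j => S^T k j * S j k)) ?SS1 ?scale1r // => j _.
    by rewrite mxE.
  under eq_bigr do rewrite scalerA -rmorphM /=.
  rewrite -scaler_suml -rmorph_sum /=.
  have := congr1 (fun M : 'M[R]_(2 * 2) => M k l) SS'; rewrite !mxE eq_sym (negbTE lk) => SS0.
  rewrite (eq_bigr (fun j => S^T k j * S j l)) ?SS0 ?scale0r // => j _.
  by rewrite mxE.
rewrite mulmx_sumr mulmx_suml -sumrN; apply: eq_bigr => j _.
rewrite -scalemxAr -scalemxAl -scalerN; congr (_ *: _).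
have VMN (M N : 'M[C]_(2 ^ 2)) :
    (V *m M *m V^t*) *m (V *m N *m V^t*) = V *m (M *m N) *m V^t*.
  by rewrite !mulmxA -[_ *m V^t* *m V]mulmxA VV' mulmx1.
by rewrite [LHS]VMN [in RHS]VMN parity_majorana mulmxN mulNmx.
Qed.

End Gaussian.

(** * Parity of Gaussian states *)

Section Parity.
Variable R : realType.
Local Notation C := R[i].
Local Notation X := (pauliX R).
Local Notation Y := (pauliY R).
Local Notation Z := (pauliZ R).
Local Notation idx := mxtens.mxtens_index.
Local Notation unidx := (@mxtens.mxtens_unindex 2 2).

Lemma pauliZ1_diag :
  Z *t (1%:M : 'M[C]_2) = diag_mx (\row_x (-1) ^+ (unidx x).1).
Proof.
apply: tensmx_eqP => i a j b; rewrite mxtens.tensmxE !mxE mxtens.mxtens_indexK.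
rewrite (can_eq (@mxtens.mxtens_indexK _ _)) xpair_eqE /=.
by case: (i == j); case: (a == b); rewrite /= ?mulr1 ?mulr0 ?mul0r.
Qed.

Lemma pauli1Z_diag :
  (1%:M : 'M[C]_2) *t Z = diag_mx (\row_x (-1) ^+ (unidx x).2).
Proof.
apply: tensmx_eqP => i a j b; rewrite mxtens.tensmxE !mxE mxtens.mxtens_indexK.
rewrite (can_eq (@mxtens.mxtens_indexK _ _)) xpair_eqE /=.
by case: (i == j); case: (a == b); rewrite /= ?mul1r ?mulr0 ?mul0r.
Qed.

(** Comparing entries at [(x, y)] multiplies [Q x y] by the sign of [y] on one side and of [x] on
    the other; if these differ, [Q x y] equals its own negative. *)
Lemma comm_sign_diag (s : 'I_(2 * 2) -> 'I_2) (Q : 'M[C]_(2 * 2)) x y :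
  Q *m diag_mx (\row_x (-1) ^+ s x) = diag_mx (\row_x (-1) ^+ s x) *m Q ->
  s x != s y -> Q x y = 0.
Proof.
move=> /matrixP/(_ x y); rewrite mul_mx_diag mul_diag_mx !mxE.
have QN : - Q x y = Q x y -> Q x y = 0.
  by move/eqP; rewrite eq_sym -addr_eq0 -mulr2n mulrn_eq0 /= => /eqP.
move: (s x) (s y); do 2!apply: ord2P => //=; rewrite ?expr0 ?expr1 ?mulrN1 ?mulN1r ?mulr1 ?mul1r.
  by move=> /QN.
by move=> /esym/QN.
Qed.

(** [Q] commutes with products of two Majorana operators, hence with [Z *t 1] and [1 *t Z], whose
    joint eigenspaces are one-dimensional; so [Q] is diagonal. Anticommutation with [1 *t X] then
    gives opposite entries when the second qubit is flipped. *)
Lemma anticomm_majorana (Q : 'M[C]_(2 * 2)) :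
  (forall k, Q *m majorana R (n := 2) k = - (majorana R (n := 2) k *m Q)) ->
  (forall x y, x != y -> Q x y = 0) /\
  (forall i, Q (idx (i, 0)) (idx (i, 0)) = - Q (idx (i, 1)) (idx (i, 1))).
Proof.
move=> Qc.
have Qcc (k l : 'I_(2 * 2)) (A B : 'M[C]_(2 * 2)) :
    majorana R (n := 2) k = A -> majorana R (n := 2) l = B ->
    Q *m (A *m B) = (A *m B) *m Q.
  move=> <- <-; rewrite [LHS]mulmxA [X in X *m _]Qc mulNmx -[X in - X]mulmxA.
  by rewrite [X in - (_ *m X)]Qc mulmxN opprK mulmxA.
have XY : X *m Y = 'i *: Z by rewrite pauliYE -scalemxAr mulmxA pauliX_sqr mul1mx.
have QZ1 : Q *m (Z *t 1%:M) = (Z *t 1%:M) *m Q.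
  have := Qcc _ _ _ _ (majorana0 R 0) (majorana0 R 1).
  rewrite mxtens.tensmx_mul mulmx1 XY tensmxZl -scalemxAr -scalemxAl.
  by apply: scalerI; exact: neq0Ci.
have Q1Z : Q *m (1%:M *t Z) = (1%:M *t Z) *m Q.
  have := Qcc _ _ _ _ (majorana1 R 0) (majorana1 R 1).
  rewrite mxtens.tensmx_mul pauliZ_sqr XY tensmxZr -scalemxAr -scalemxAl.
  by apply: scalerI; exact: neq0Ci.
split.
  move=> x y xy; have [x1|] := eqVneq (unidx x).1 (unidx y).1; last first.
    by apply: (comm_sign_diag (s := fun x => (unidx x).1)); rewrite -pauliZ1_diag.
  apply: (comm_sign_diag (s := fun x => (unidx x).2)); first by rewrite -pauli1Z_diag.
  apply: contra xy => /eqP x2; apply/eqP/(can_inj (@mxtens.mxtens_unindexK 2 2)).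
  exact: injective_projections.
move=> i.
have Q1X : Q *m (1%:M *t X) = - ((1%:M *t X) *m Q).
  have Z1_sqr : (Z *t (1%:M : 'M[C]_2)) *m (Z *t 1%:M) = 1%:M.
    by rewrite mxtens.tensmx_mul pauliZ_sqr mulmx1 tensmx11.
  have ZX : Z *t X = (Z *t 1%:M) *m (1%:M *t X).
    by rewrite mxtens.tensmx_mul mulmx1 mul1mx.
  (* The factor [Z *t 1] of [Z *t X] is an involution commuting with [Q], so it can be cancelled. *)
  have := Qc (idx (1 : 'I_2, 0 : 'I_2)); rewrite majorana1 /pauliXY /= ZX.
  rewrite mulmxA QZ1 => /(congr1 (mulmx (Z *t 1%:M))).
  by rewrite mulmxN !mulmxA Z1_sqr !mul1mx.
(* Entry [(0, 1)] of a block times [X] is its entry [(0, 0)]; that of [X] times the block is its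
   entry [(1, 1)]. *)
have := congr1 (fun M => blockmx i i M 0 1) Q1X.
rewrite /= blockmx_mulr.
have -> : blockmx i i (- ((1%:M *t X) *m Q)) = - (X *m blockmx i i Q).
  by rewrite -blockmx_mull; apply/matrixP => a b; rewrite !mxE.
rewrite !mxE !big_ord_recl !big_ord0 !mxE /=.
have -> : lift ord0 ord0 = 1 :> 'I_2 by exact: val_inj.
by rewrite !(mulr1, mulr0, mul0r, mul1r, addr0, add0r).
Qed.

Lemma parity_ket0 : (Z *t Z) *m ket0 R 2 = ket0 R 2.
Proof.
have Z0 : Z *m (delta_mx 0 0 : 'cV[C]_2) = delta_mx 0 0.
  apply/matrixP => j k; rewrite [k]ord1 {k}; move: j; apply: ord2P;
    rewrite !mxE !big_ord_recl big_ord0 !mxE /=;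
    by rewrite !(mulr0, mul0r, mulr1, addr0, add0r, expr0).
have ZZ : (Z *t Z) *m ((delta_mx 0 0 : 'cV[C]_2) *t (delta_mx 0 0 : 'cV[C]_2)) =
    (delta_mx 0 0 : 'cV[C]_2) *t (delta_mx 0 0 : 'cV[C]_2).
  by rewrite mxtens.tensmx_mul !Z0.
by rewrite /ket0 castmx_id; exact: ZZ.
Qed.

(** The conjugated parity [Q] is diagonal and fixes [psi], so its entry is 1 wherever [psi] is
    nonzero; its entries at [(i, 0)] and [(i, 1)] are opposite and cannot both be 1. *)
Lemma pure_gaussian_parity (psi : 'cV[C]_(2 * 2)) (i : 'I_2) :
  pure_gaussian (n := 2) psi -> psi (idx (i, 0)) 0 = 0 \/ psi (idx (i, 1)) 0 = 0.
Proof.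
move=> [V VG psiE]; pose Q : 'M[C]_(2 * 2) := V *m (Z *t Z) *m V^t*.
have [Qdiag Qsign] := anticomm_majorana (fun k => conj_parity_majorana k VG).
have VV : V^t* *m V = 1%:M by apply: mulmx1C; case: VG => /unitarymxP.
have Qpsi : Q *m psi = psi.
  by rewrite /Q psiE mulmxA -[X in X *m _]mulmxA VV mulmx1 -mulmxA parity_ket0.
rewrite -/Q in Qdiag Qsign; clearbody Q.
have Qx x : Q x x * psi x 0 = psi x 0.
  transitivity ((Q *m psi) x 0); last by rewrite Qpsi.
  by rewrite mxE (bigD1 x) //= big1 ?addr0 // => y yx; rewrite Qdiag ?mul0r // eq_sym.
have [->|p0] := eqVneq (psi (idx (i, 0)) 0) 0; first by left.
right; have := Qx (idx (i, 0)); rewrite Qsign => Q0.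
have Q1 : Q (idx (i, 1)) (idx (i, 1)) = -1.
  by apply: (mulIf p0); rewrite mulN1r -[in RHS]Q0 mulNr opprK.
have /eqP := Qx (idx (i, 1)); rewrite Q1 mulN1r eq_sym -addr_eq0 -mulr2n.
by rewrite mulrn_eq0 => /eqP.
Qed.

Lemma pure_gaussian_norm (psi : 'cV[C]_(2 ^ 2)) :
  pure_gaussian (n := 2) psi -> psi^t* *m psi = 1%:M.
Proof.
move=> [V [/unitarymxP/mulmx1C VV _] ->].
rewrite adjmx_mul mulmxA -[X in X *m _]mulmxA VV mulmx1 ket0_2 adjmx_delta.
by rewrite mul_delta_mx; apply/matrixP => i j; rewrite !ord1 !mxE !eqxx.
Qed.

(** These properties make the diagonal of [rho] a probability distribution and remove the coherences
    that the projections in the Kraus operators would keep. *)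
Lemma convex_gaussian_diag (rho : 'M[C]_(2 * 2)) :
  convex_gaussian (n := 2) rho ->
  [/\ forall i a b, a != b -> rho (idx (i, a)) (idx (i, b)) = 0,
      forall x, 0 <= rho x x & \tr rho = 1].
Proof.
move=> [m [w [psi [w0 w1 psiG ->]]]]; split.
- have cross (i a b : 'I_2) l : a != b ->
      psi l (idx (i, a)) 0 * Num.conj (psi l (idx (i, b)) 0) = 0.
    have := pure_gaussian_parity i (psiG l); move: a b; do 2!apply: ord2P => //=;
      by case=> -> _; rewrite ?conjC0 ?mulr0 ?mul0r.
  move=> i a b ab; rewrite summxE big1 // => l _.
  by rewrite !mxE big_ord_recl big_ord0 addr0 !mxE cross ?mulr0.
- move=> x; rewrite summxE sumr_ge0 // => l _.
  rewrite !mxE big_ord_recl big_ord0 addr0 !mxE mulr_ge0 ?ler0c //.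
  exact: mul_conjC_ge0.
- rewrite raddf_sum /= -[RHS](rmorph1 (real_complex R)) -w1 rmorph_sum /=.
  apply: eq_bigr => l _; rewrite mxtraceZ mxtrace_mulC (pure_gaussian_norm (psiG l)).
  by rewrite mxtrace1 mulr1.
Qed.

End Parity.

(** * The adaptive rotation on convex-Gaussian states *)

Section AdaptiveRotation.
Variable R : realType.
Local Notation C := R[i].
Local Notation idx := mxtens.mxtens_index.

Lemma RZ_offdiag (theta : R) (a b : 'I_2) : a != b -> RZ theta a b = 0.
Proof. by move=> /negbTE ab; rewrite RZE !mxE ab mulr0n !mulr0 subr0. Qed.

Lemma ketbra_tens_RZ_offdiag (c : 'I_2) (theta : R) (x y : 'I_(2 * 2)) :
  x != y -> (ketbra R c *t RZ theta) x y = 0.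
Proof.
case: (mxtens.mxtens_indexP x) => i a; case: (mxtens.mxtens_indexP y) => j b.
rewrite (can_eq (@mxtens.mxtens_indexK _ _)) xpair_eqE negb_and mxtens.tensmxE.
case/orP => [ij|ab]; last by rewrite RZ_offdiag ?mulr0.
rewrite mxE; case: (eqVneq i c) => [ic|_]; rewrite ?mul0r //=.
by rewrite -ic eq_sym (negbTE ij) mul0r.
Qed.

Lemma conj_map_diagonal (d : nat) (K M : 'M[C]_d) :
  (forall x y, x != y -> K x y = 0) ->
  forall x y, conj_map K M x y = K x x * M x y * Num.conj (K y y).
Proof.
move=> K0 x y; rewrite mxE (bigD1 y) //= big1 ?addr0 => [|z zy]; last first.
  by rewrite !mxE [K y z]K0 1?eq_sym // conjC0 mulr0.
rewrite !mxE (bigD1 x) //= big1 ?addr0 // => z zx.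
by rewrite K0 ?mul0r // eq_sym.
Qed.

Lemma adjmx_mul_diagonal (d : nat) (K : 'M[C]_d) :
  (forall x y, x != y -> K x y = 0) ->
  forall x, (K^t* *m K) x x = K x x * Num.conj (K x x).
Proof.
move=> K0 x; rewrite mxE (bigD1 x) //= big1 ?addr0 => [|z zx]; last first.
  by rewrite K0 ?mulr0.
by rewrite !mxE mulrC.
Qed.

(** A diagonal entry [M x x] gets the factor [|A x x|^2 + |B x x|^2], which completeness makes 1;
    the off-diagonal entries vanish by assumption. *)
Lemma kraus_diagonal (d : nat) (A B M : 'M[C]_d) :
  (forall x y, x != y -> A x y = 0) -> (forall x y, x != y -> B x y = 0) ->
  A^t* *m A + B^t* *m B = 1%:M ->
  (forall x y, x != y -> conj_map A M x y = 0) ->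
  (forall x y, x != y -> conj_map B M x y = 0) ->
  conj_map A M + conj_map B M = \sum_x M x x *: delta_mx x x.
Proof.
move=> dA dB AB1 MA MB.
have -> : \sum_x M x x *: delta_mx x x = diag_mx (\row_x M x x).
  by rewrite diag_mx_sum_delta; apply: eq_bigr => x _; rewrite mxE.
apply/matrixP => x y; rewrite [LHS]mxE.
have [<-|xy] := eqVneq x y; last by rewrite MA // MB // addr0 !mxE (negbTE xy).
have := congr1 (fun N : 'M[C]_d => N x x) AB1.
rewrite mxE [RHS]mxE eqxx !adjmx_mul_diagonal // !conj_map_diagonal // mulr1n => AB1x.
by rewrite !mxE eqxx mulr1n -[RHS]mulr1 -AB1x mulrDr !mulrA ![_ * M x x]mulrC.
Qed.

(** The Kraus operator being diagonal, entry [(x, y)] of [rho] is only rescaled. It is zero already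
    if the first qubits agree; otherwise the projection on [c] annihilates one side. *)
Lemma conj_map_ketbra_RZ_offdiag (c : 'I_2) (theta : R) (rho : 'M[C]_(2 * 2)) :
  (forall i a b, a != b -> rho (idx (i, a)) (idx (i, b)) = 0) ->
  forall x y, x != y -> conj_map (ketbra R c *t RZ theta) rho x y = 0.
Proof.
move=> rho0 x y xy; rewrite conj_map_diagonal; last exact: ketbra_tens_RZ_offdiag.
move: xy; case: (mxtens.mxtens_indexP x) => i a; case: (mxtens.mxtens_indexP y) => j b.
rewrite (can_eq (@mxtens.mxtens_indexK _ _)) xpair_eqE negb_and !mxtens.tensmxE.
have [<- /= ab|ij _] := eqVneq i j; first by rewrite rho0 // mulr0 mul0r.
rewrite !mxE; have [ic|_] := eqVneq i c; last by rewrite !mul0r.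
by rewrite -ic [j == i]eq_sym (negbTE ij) mul0r conjC0 mulr0.
Qed.

Lemma adaptive_RZ_diagonal (theta : R) (rho : 'M[C]_(2 * 2)) :
  (forall i a b, a != b -> rho (idx (i, a)) (idx (i, b)) = 0) ->
  adaptive_RZ theta rho = \sum_x rho x x *: delta_mx x x.
Proof.
move=> rho0; apply: (kraus_diagonal (A := K0 theta) (B := K1 theta)).
- exact: ketbra_tens_RZ_offdiag.
- exact: ketbra_tens_RZ_offdiag.
- exact: kraus_complete.
- exact: conj_map_ketbra_RZ_offdiag.
- exact: conj_map_ketbra_RZ_offdiag.
Qed.

Lemma adaptive_RZ_convex_gaussian (theta : R) (rho : 'M[C]_(2 ^ 2)) :
  convex_gaussian (n := 2) rho -> convex_gaussian (n := 2) (adaptive_RZ theta rho).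
Proof.
move=> /convex_gaussian_diag[rho0 rho_ge0 rho_tr].
have rhoE x : (complex.Re (rho x x))%:C = rho x x.
  by rewrite RRe_real // ger0_real // rho_ge0.
(* The mixture consists of the four basis states, weighted by the diagonal of [rho], which is real
   because it is nonnegative. *)
exists (2 * 2)%N, (fun x => complex.Re (rho x x)), (fun x => delta_mx x 0); split.
- by move=> x; rewrite -ler0c rhoE rho_ge0.
- apply: complexI; rewrite rmorph_sum rmorph1 -rho_tr /=; apply: eq_bigr => x _; exact: rhoE.
- exact: basis_pure_gaussian.
- rewrite adaptive_RZ_diagonal //; apply: eq_bigr => x _.
  by rewrite rhoE adjmx_delta mul_delta_mx.
Qed.

Lemma adaptive_RZ_convex_gaussian_channel (theta : R) :
  convex_gaussian_channel (n := 2) (adaptive_RZ theta).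
Proof.
by split; [exact: cptp_adaptive_RZ | exact: adaptive_RZ_convex_gaussian].
Qed.

End AdaptiveRotation.

(** The weight [1 - 2 * p] of the unitary part must be nonnegative, whence the condition
    [p <= 1 / 2] on feasibility. *)
Theorem lemma22 (R : realType) (theta p : R) (hp : 0 <= p <= 1) :
  [/\ forall M : 'M[R[i]]_(2 ^ 2),
        noisy_RZZ theta p M =
          (1 - 2 * p)%:C *: RZZ_channel theta M
          + (2 * p)%:C *: adaptive_RZ theta M,
      unitary_channel (RZZ_channel theta),
      convex_gaussian_channel (n := 2) (adaptive_RZ theta)
    & p <= 1 / 2 ->
      feasible_decomposition (n := 2) (noisy_RZZ theta p)
        (fun _ : 'I_1 => 1 - 2 * p) (fun _ : 'I_1 => RZZ_channel theta)
        (fun _ : 'I_1 => 2 * p) (fun _ : 'I_1 => adaptive_RZ theta)].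
Proof.
have RZZ_channelP : unitary_channel (RZZ_channel theta).
  by exists (RZZ theta); [exact: RZZ_unitary | move=> M].
have adaptiveP := adaptive_RZ_convex_gaussian_channel theta.
split; [exact: noisy_RZZE | exact: RZZ_channelP | exact: adaptiveP | move=> p_half].
have [p0 p1] := andP hp.
split; first exact: cptp_noisy_RZZ.
split; [by [] | by [] | split=> _ | |].
- by rewrite subr_ge0 mulrC -ler_pdivlMr.
- by rewrite mulr_ge0.
- by rewrite !big_ord1 subrK.
- by move=> M; rewrite !big_ord1 noisy_RZZE.
Qed.
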